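(* Let $G$ be a finite group and let $M$ and $M'$ be cut cellular surfaces related by a single move of type I or of type II (so that they have the same ''in'' boundary components, $n$ in number, and the same ''out'' boundary components, $m$ in number). Then for all $g_1,\dots,g_n,h_1,\dots,h_m\in G$, $$\left\langle h_1,\dots,h_m\left|Z_M\right|g_1,\dots,g_n\right\rangle=\left\langle h_1,\dots,h_m\left|Z_{M'}\right|g_1,\dots,g_n\right\rangle .$$ That is, the invariants are unchanged under moves I and II.
   Context: Cut cellular surfaces. A cut cellular surface (CCS) is an orientable 2-manifold $M$ with (possibly empty) boundary, endowed with a finite cell structure (0-, 1- and 2-cells), such that: (a) each boundary component of $M$ consists of a single 0-cell and a single 1-cell. (b) $M$ has a specified planar representation, obtained by cutting $M$ along 1-cells so as to obtain a simply connected region in the plane bounded by ''external'' 1-cells, namely the boundary 1-cells and the 1-cells along which $M$ was cut (''cut 1-cells''; each appears twice in the boundary of the planar region). The cut 1-cells are labelled and oriented to make explicit how they are identified in $M$. (c) The boundary components lie either along the bottom edge of the planar representation (the ''in'' components) or along the top edge (the ''out'' components); when there are no in (resp. out) components, the bottom (resp. top) edge is a single 0-cell. On the left side, on the right side, and between consecutive boundary components along the bottom and top edges there are one or more cut 1-cells, separated by 0-cells when there are more than one. (d) The planar region is made up of one or more 2-cells, separated by ''internal'' 1-cells and 0-cells. Moves. Move I: introducing a 0-cell into a 1-cell, dividing it into two 1-cells, or conversely removing a 0-cell separating two 1-cells so as to combine them into a single 1-cell. It applies only to 1-cells that are not boundary components of $M$; when applied to a cut 1-cell it is performed simultaneously on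 both copies in the planar representation. Move II: introducing a 1-cell into a 2-cell, dividing it into two 2-cells, or conversely removing a 1-cell separating two 2-cells so as to combine them into a single 2-cell. The 1-cell introduced or removed connects two 0-cells in the boundary of the 2-cell in the planar representation, and these may be the same 0-cell. Colourings and invariant. Fix a finite group $G$. Orient the 1-cells of $M$: boundary 1-cells from left to right in the planar representation, cut 1-cells as specified in (b), internal 1-cells arbitrarily. A $G$-colouring of $M$ is an assignment of an element $g_i\in G$ to each 1-cell $i$ such that for each 2-cell in the planar representation, if the 1-cells of its boundary in anticlockwise order are $i_1,\dots,i_k$, then $\prod_{j=1}^k g_{i_j}^{\pm1}=1$ (flatness), where the exponent is $+1$ if the 1-cell $i_j$ is oriented compatibly with the positive (anticlockwise) orientation of the 2-cell, and $-1$ otherwise. Suppose $M$ has $n$ in and $m$ out boundary components, ordered from left to right. Let $\mathcal C(g_1,\dots,g_n;h_1,\dots,h_m)$ be the set of $G$-colourings of $M$ assigning $g_1,\dots,g_n$ to the in boundary components and $h_1,\dots,h_m$ to the out boundary components, and let $v$ be the number of internal vertices of $M$ (0-cells not lying on the boundary of $M$). The invariant is $$\langle h_1,\dots,h_m|Z_M|g_1,\dots,g_n\rangle:=\frac{1}{|G|^{\frac{m+n}{2}+v}}\,\#\mathcal C(g_1,\dots,g_n;h_1,\dots,h_m),$$ with an empty list written $\emptyset$ when there are no in (or out) components. *)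

(* Defs.v *)
From HB Require Import structures.
From mathcomp Require Import all_boot all_order all_algebra all_fingroup.
From mathcomp Require Import reals exp.

Set Implicit Arguments.
Unset Strict Implicit.
Unset Printing Implicit Defensive.

Import GRing.Theory Num.Theory.

Local Open Scope ring_scope.

(* The planar region is encoded by the sides of its 2-cells: a side is an
   occurrence of a 1-cell in the anticlockwise boundary of a 2-cell, directed
   along that boundary.  The 2-cells are the orbits of [next_side].
   - [opp_side] exchanges the two sides of an internal 1-cell, and fixes the
     external sides;
   - [cut_twin] exchanges the two copies of a cut 1-cell, and fixes all other sides.
   Paired sides run along their common 1-cell in opposite directions, so the
   surfaces obtained are oriented.
   [ins] and [outs] list the boundary 1-cells from left to right. *)
Record planar_rep (n m : nat) := PlanarRep {
  side : finType;
  next_side : side -> side;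
  opp_side : side -> side;
  cut_twin : side -> side;
  ins : n.-tuple side;
  outs : m.-tuple side }.

Arguments next_side {n m p}.
Arguments opp_side {n m p}.
Arguments cut_twin {n m p}.

Section CellStructure.

Variables (n m : nat) (P : planar_rep n m).
Implicit Types (d x y : side P) (a : side P -> side P).

Definition external d := opp_side d == d.

(* The pairing of the sides in the surface M; its fixed points are the boundary
   1-cells. *)
Definition glue d := opp_side (cut_twin d).
Definition boundary d := glue d == d.
Definition cut d := external d && ~~ boundary d.

(* For a pairing [a] of sides, the 0-cells of the cell complex obtained by gluing
   the 2-cells along [a] are represented by the sets of sides which start there.
   If [x] is paired with [a x] then [a x] ends where [x] starts, and so
   [next_side (a x)] starts where [x] starts. *)
Definition turn a : rel (side P) := [rel x y | (a x != x) && (y == next_side (a x))].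
Definition same_origin a : rel (side P) :=
  connect [rel x y | turn a x y || turn a y x].
Definition zero_cells a : {set {set side P}} :=
  equivalence_partition (same_origin a) setT.
Definition one_cells a : {set {set side P}} := [set [set x; a x] | x : side P].

(* Gluing along [opp_side] gives the planar region, gluing along [glue] gives M. *)

(* A connected, oriented surface with nonempty boundary and Euler characteristic
   1 is a disc. *)
Definition is_disc : Prop :=
  (forall x y, connect [rel x y | (y == next_side x) || (y == opp_side x)] x y) /\
  (#|zero_cells opp_side| + fcard (@next_side n m P) (side P)
     = #|one_cells opp_side| + 1)%N.

(* The bottom or top edge: it is a single 0-cell, or else it starts and ends with
   a boundary 1-cell and has at least one cut 1-cell between any two consecutive
   boundary 1-cells. *)
Definition horizontal_edge (s : seq (side P)) : bool :=
  sorted (fun x y => ~~ (boundary x && boundary y)) s &&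
  (if s is x :: s' then boundary x && boundary (last x s') else true).

Definition vertical_edge (s : seq (side P)) : bool := (s != [::]) && all cut s.

(* [bottom] and [top] are listed from left to right, [right] upwards and [left]
   downwards. *)
Definition frame (bottom right top left : seq (side P)) : Prop :=
  let ext := bottom ++ right ++ rev top ++ left in
  [/\ uniq ext /\ ext =i external,
      path.cycle (fun x y => same_origin opp_side (next_side x) y) ext,
      horizontal_edge bottom /\ horizontal_edge top,
      vertical_edge right /\ vertical_edge left &
      [seq x <- bottom | boundary x] = ins P /\
      [seq x <- top | boundary x] = outs P].

Definition is_ccs : Prop :=
  [/\ injective (@next_side n m P),
      [/\ involutive (@opp_side n m P), involutive (@cut_twin n m P) &
          forall d, opp_side d = d \/ cut_twin d = d],
      is_disc,
      exists bottom right top left, frame bottom right top left &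
      forall d, boundary d -> same_origin glue d (next_side d)].

Definition internal_zero_cells : {set {set side P}} :=
  [set V in zero_cells glue |
     [forall d, boundary d ==> (d \notin V) && (next_side d \notin V)]].

End CellStructure.

(* [cut_pos d] says that the side [d] runs in the chosen direction of its cut
   1-cell. *)
Record ccs (n m : nat) := CCS {
  rep :> planar_rep n m;
  repP : is_ccs rep;
  cut_pos : pred (side rep);
  cut_posP : forall d, cut d -> cut_pos (cut_twin d) = ~~ cut_pos d }.

(* [pos d] says that the side [d] is directed like its 1-cell.  Anticlockwise is
   from left to right along the bottom edge and from right to left along the top
   edge. *)
Record orientation (n m : nat) (M : ccs n m) := Orientation {
  pos :> pred (side M);
  pos_in : forall d, d \in ins M -> pos d;
  pos_out : forall d, d \in outs M -> ~~ pos d;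
  pos_cut : forall d, cut d -> pos d = cut_pos d;
  pos_internal : forall d, ~~ external d -> pos (opp_side d) = ~~ pos d }.

Section Invariant.

Variables (gT : finGroupType) (n m : nat) (M : ccs n m) (o : orientation M).

Definition one_cell := {c : {set side M} | c \in one_cells (@glue _ _ M)}.

Lemma mem_one_cells (d : side M) : [set d; glue d] \in one_cells (@glue _ _ M).
Proof. exact: imset_f. Qed.

Definition cell_of (d : side M) : one_cell :=
  exist _ [set d; glue d] (mem_one_cells d).

Definition holonomy (c : {ffun one_cell -> gT}) (d : side M) : gT :=
  if o d then c (cell_of d) else ((c (cell_of d))^-1)%g.

(* Each 2-cell is read from every starting point; these conditions are
   conjugate. *)
Definition flat (c : {ffun one_cell -> gT}) : bool :=
  [forall d : side M,
     (\prod_(x <- fingraph.orbit next_side d) holonomy c x == 1)%g].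

Definition colourings (g : n.-tuple gT) (h : m.-tuple gT) :
    {set {ffun one_cell -> gT}} :=
  [set c | [&& flat c,
               [forall i, c (cell_of (tnth (ins M) i)) == tnth g i] &
               [forall j, c (cell_of (tnth (outs M) j)) == tnth h j]]].

Definition ccs_invariant (R : realType) (h : m.-tuple gT) (g : n.-tuple gT) : R :=
  1 / (#|gT|%:R `^ ((m + n)%:R / 2 + #|internal_zero_cells M|%:R))
    * #|colourings g h|%:R.

End Invariant.

Section Moves.

Variables n m : nat.

Definition rep_iso (P Q : planar_rep n m) (f : side P -> side Q) : Prop :=
  [/\ bijective f,
      forall x, f (next_side x) = next_side (f x),
      (forall x, f (opp_side x) = opp_side (f x)) /\
      (forall x, f (cut_twin x) = cut_twin (f x)) &
      map_tuple f (ins P) = ins Q /\ map_tuple f (outs P) = outs Q].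

Section Subdivide.

(* A 0-cell is introduced into the 1-cell with sides [d] and [glue d].  The first
   halves of these two sides keep their names, and their second halves are
   [inr true] and [inr false] respectively.  The first half of each side is paired
   with the second half of the other one. *)
Variables (P : planar_rep n m) (d : side P).

Definition subdivide_next (x : side P + bool) : side P + bool :=
  match x with
  | inl y => if y == d then inr true
             else if y == glue d then inr false else inl (next_side y)
  | inr b => inl (next_side (if b then d else glue d))
  end.

Definition subdivide_pairing (a : side P -> side P) (x : side P + bool) :
    side P + bool :=
  match x with
  | inl y => if a y == y then inl y
             else if y == d then inr false
             else if y == glue d then inr true else inl (a y)
  | inr b => let y := if b then d else glue d in
             if a y == y then inr b else inl (a y)
  end.

Definition subdivide : planar_rep n m :=
  @PlanarRep n m (side P + bool)%type subdivide_next
    (subdivide_pairing opp_side) (subdivide_pairing cut_twin)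
    (map_tuple inl (ins P)) (map_tuple inl (outs P)).

End Subdivide.

Section SplitFace.

(* A 1-cell joining the origins of the sides [x] and [y] of one 2-cell is
   introduced into it.  The 2-cell (x ... x' y ... y') is divided into the 2-cells
   (x ... x' [inr false]) and (y ... y' [inr true]); if [x = y], the first of these
   is just ([inr false]). *)
Variables (P : planar_rep n m) (x y : side P).

Definition split_next (z : side P + bool) : side P + bool :=
  match z with
  | inl t => if next_side t == x then inr true
             else if next_side t == y then inr false else inl (next_side t)
  | inr true => inl y
  | inr false => if x == y then inr false else inl x
  end.

Definition split_opp (z : side P + bool) : side P + bool :=
  match z with inl t => inl (opp_side t) | inr b => inr (~~ b) end.

Definition split_cut_twin (z : side P + bool) : side P + bool :=
  match z with inl t => inl (cut_twin t) | inr b => inr b end.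

Definition split_face : planar_rep n m :=
  @PlanarRep n m (side P + bool)%type split_next split_opp split_cut_twin
    (map_tuple inl (ins P)) (map_tuple inl (outs P)).

End SplitFace.

(* Cut 1-cells which are not subdivided keep their direction, while the two halves
   of a subdivided one may be directed in any way, so that any two cut 1-cells
   separated by a 0-cell can be combined. *)
Definition introduces_zero_cell (M M' : ccs n m) : Prop :=
  exists (d : side M) (f : side (subdivide d) -> side M'),
    [/\ ~~ boundary d, rep_iso f &
        forall x, cut x -> x \notin [set d; glue d] ->
          cut_pos (f (inl x)) = cut_pos x].

Definition introduces_one_cell (M M' : ccs n m) : Prop :=
  exists (x y : side M) (f : side (split_face x y) -> side M'),
    [/\ fconnect next_side x y, rep_iso f &
        forall z, cut z -> cut_pos (f (inl z)) = cut_pos z].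

Definition moveI (M M' : ccs n m) : Prop :=
  introduces_zero_cell M M' \/ introduces_zero_cell M' M.

Definition moveII (M M' : ccs n m) : Prop :=
  introduces_one_cell M M' \/ introduces_one_cell M' M.

End Moves.

(* Main.v *)
(* Recording the holonomy along each side turns colourings into flat
   connections, which no longer depend on the orientation of the 1-cells.
   Flatness means that the holonomies of a 2-cell are the increments of a
   potential defined on its corners.  When a 1-cell is subdivided, the holonomy
   of its first half can be chosen freely and determines that of the second:
   there are |G| times as many connections, and one more internal 0-cell.  A
   1-cell introduced into a 2-cell has its holonomy forced to be the potential
   difference between its ends, and the internal 0-cells are unchanged. *)

Require Import Defs.
From HB Require Import structures.
From mathcomp Require Import all_boot all_order all_algebra all_fingroup.
From mathcomp Require Import reals exp.

Set Implicit Arguments.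
Unset Strict Implicit.
Unset Printing Implicit Defensive.

Import GRing.Theory Num.Theory.

Local Open Scope group_scope.

Local Notation same_0cell := (same_origin (@glue _ _ _)).

(** * Counting and connectivity in finite types *)

Lemma card_in_bij (T T' : finType) (A : {set T}) (B : {set T'})
    (F : T -> T') (F' : T' -> T) :
  {in A, forall x, F x \in B} -> {in B, forall y, F' y \in A} ->
  {in A, cancel F F'} -> {in B, cancel F' F} -> #|A| = #|B|.
Proof.
move=> FB FA FK FK'; rewrite -(card_in_imset (can_in_inj FK)).
apply: eq_card => y; apply/imsetP/idP => [[x xA ->]|yB]; first exact: FB.
by exists (F' y); [exact: FA | rewrite FK'].
Qed.

Lemma connect_homo (T T' : finType) (e : rel T) (e' : rel T') (f : T -> T') :
  (forall x y, e x y -> connect e' (f x) (f y)) ->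
  forall x y, connect e x y -> connect e' (f x) (f y).
Proof.
move=> ef x y /connectP[p ep ->]; elim: p x ep => [|z p IHp] x //=.
by case/andP=> /ef exz /IHp; apply: connect_trans.
Qed.

(** The classes of [R] are the preimages under [j] of the classes of [R'], and taking preimages is
    injective on the classes that meet the image of [j]. This compares 0-cells of two surfaces
    through a map of sides. *)
Lemma card_classes (T T' : finType) (R : rel T) (R' : rel T') (j : T -> T')
    (A : {set T}) :
  equivalence_rel R' -> (forall x y, R' (j x) (j y) = R x y) ->
  #|[set [set y | R x y] | x in A]| =
  #|[set [set y | R' x y] | x in j @: A]|.
Proof.
move=> eqR' jR; have -> : [set [set y | R x y] | x in A] =
    [set j @^-1: W | W : {set T'} in [set [set y | R' x y] | x in j @: A]].
  rewrite -!imset_comp; apply: eq_imset => x /=.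
  by apply/setP=> y; rewrite !inE jR.
apply: card_in_imset => ? ? /imsetP[_ /imsetP[x _ ->] ->].
(* If the classes of [j x] and [j x'] have the same preimage, then [x] lies in it, so [j x] lies in
   both classes. *)
move=> /imsetP[_ /imsetP[x' _ ->] ->] /setP /(_ x); rewrite !inE.
have [-> _] := eqR' (j x) (j x) (j x); move=> /esym Rx'x.
apply/setP=> z; rewrite !inE; apply/esym.
by have [_ ->] := eqR' (j x') (j x) z.
Qed.

(** * Flat connections and potentials *)

Section Flatness.

Variables (gT : finGroupType) (T : finType) (f : T -> T).
Implicit Types phi p : T -> gT.

Definition flat_along phi : bool :=
  [forall d, \prod_(x <- fingraph.orbit f d) phi x == 1].

(** The increments of a potential telescope along a trajectory. *)
Lemma prod_traject phi p :
  (forall x, p (f x) = p x * phi x) ->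
  forall k x, p (iter k f x) = p x * \prod_(y <- traject f x k) phi y.
Proof.
move=> pf; elim=> [|k IHk] x; first by rewrite big_nil mulg1.
by rewrite iterSr IHk trajectS big_cons pf mulgA.
Qed.

Hypothesis f_inj : injective f.

(* A flat connection integrates to a potential along each orbit; unlike the
   product over the orbit, this is a local condition. *)
Lemma flat_alongP phi :
  reflect (exists p : T -> gT, forall x, p (f x) = p x * phi x)
          (flat_along phi).
Proof.
apply: (iffP forallP) => [phi1|[p pf] d].
  pose r := froot f.
  (* The potential at [x] is the product of [phi] from the root of its orbit up to [x], with [x]
     itself excluded. *)
  exists (fun x => \prod_(y <- traject f (r x) (findex f (r x) x)) phi y) => x.
  have fsym := fconnect_sym f_inj.
  have rx : fconnect f (r x) x by rewrite fsym connect_root.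
  have -> : r (f x) = r x.
    by apply/eqP; rewrite /r root_connect // fsym fconnect1.
  have lt_k := findex_max rx; have fxE := iter_findex rx.
  set k := findex f (r x) x in lt_k fxE *.
  have fxE' : f x = iter k.+1 f (r x) by rewrite iterS fxE.
  have -> : (\prod_(y <- traject f (r x) k) phi y) * phi x =
            \prod_(y <- traject f (r x) k.+1) phi y.
    by rewrite trajectSr -cats1 big_cat big_seq1 fxE.
  (* If [x] is the last point before the root, the product runs over the whole orbit and is [1] by
     flatness, which agrees with the empty product at the root. *)
  move: lt_k; rewrite leq_eqVlt => /orP[/eqP kE|lt_k].
    have -> : f x = r x by rewrite fxE' kE iter_order.
    by rewrite findex0 big_nil kE (eqP (phi1 _)).
  by rewrite fxE' findex_iter.
(* Conversely, a full turn brings the potential back to [p d], so the product over the orbit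
   cancels. *)
have := prod_traject pf (fingraph.order f d) d; rewrite iter_order // => /eqP.
by rewrite -{1}[p d]mulg1 (inj_eq (mulgI _)) eq_sym.
Qed.

End Flatness.

(** * The pairing of sides in the surface *)

Section CellStructure.

Variables (n m : nat) (P : planar_rep n m).
Hypothesis P_ccs : is_ccs P.
Implicit Types d x y : side P.

Lemma next_side_inj : injective (@next_side n m P).
Proof. by case: P_ccs. Qed.

Lemma opp_sideK : involutive (@opp_side n m P).
Proof. by case: P_ccs => _ []. Qed.

Lemma cut_twinK : involutive (@cut_twin n m P).
Proof. by case: P_ccs => _ []. Qed.

Lemma opp_or_cut_fix d : opp_side d = d \/ cut_twin d = d.
Proof. by case: P_ccs => _ []. Qed.

(** A side moved by [cut_twin] is fixed by [opp_side], and so is its twin. Hence at each side [glue]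
    reduces to one of the two involutions. *)
Lemma glue_cases d :
  (cut_twin d = d /\ glue d = opp_side d) \/
  [/\ cut_twin d != d, opp_side d = d, opp_side (cut_twin d) = cut_twin d &
      glue d = cut_twin d].
Proof.
have [cd|cd] := eqVneq (cut_twin d) d; first by left; rewrite /glue cd.
have fixes_opp (e : side P) : cut_twin e != e -> opp_side e = e.
  by case: (opp_or_cut_fix e) => // ->; rewrite eqxx.
have oc : opp_side (cut_twin d) = cut_twin d.
  by apply: fixes_opp; rewrite cut_twinK eq_sym.
by right; split; rewrite /glue ?oc ?(fixes_opp d).
Qed.

(** A composite of two involutions need not be one; here no side is moved by both. *)
Lemma glueK : involutive (@glue n m P).
Proof.
move=> d; case: (glue_cases d) => [[cd ->]|[cd od oc ->]].
  have [od|od] := eqVneq (opp_side d) d; first by rewrite od /glue cd.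
  have [|co] := opp_or_cut_fix (opp_side d).
    by rewrite opp_sideK => /esym/eqP; rewrite (negPf od).
  by rewrite /glue co opp_sideK.
by rewrite /glue cut_twinK.
Qed.

Lemma glue_eq x y : (glue x == y) = (x == glue y).
Proof. by rewrite -(inj_eq (inv_inj glueK)) glueK. Qed.

Lemma boundary_glue d : boundary (glue d) = boundary d.
Proof. by rewrite /boundary glueK eq_sym. Qed.

Lemma boundary_ins i : boundary (tnth (ins P) i).
Proof.
case: P_ccs => _ _ _ [b [r [t [l [_ _ _ _ [eb _]]]]]] _.
by have := mem_tnth i (ins P); rewrite memtE -eb mem_filter => /andP[].
Qed.

Lemma boundary_outs i : boundary (tnth (outs P) i).
Proof.
case: P_ccs => _ _ _ [b [r [t [l [_ _ _ _ [_ et]]]]]] _.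
by have := mem_tnth i (outs P); rewrite memtE -et mem_filter => /andP[].
Qed.

End CellStructure.

(** * From colourings to connections *)

Section Connections.

Variable gT : finGroupType.

(* Colourings by their holonomies along the sides: this no longer refers to the
   orientation of the 1-cells. *)
Definition connections n m (P : planar_rep n m) (g : n.-tuple gT)
    (h : m.-tuple gT) : {set {ffun side P -> gT}} :=
  [set phi : {ffun side P -> gT} |
     [&& flat_along next_side phi,
         [forall d : side P, ~~ boundary d ==> (phi (glue d) == (phi d)^-1)],
         [forall i, phi (tnth (ins P) i) == tnth g i] &
         [forall j, phi (tnth (outs P) j) == (tnth h j)^-1]]].

Variables n m : nat.
Variables (g : n.-tuple gT) (h : m.-tuple gT).

Lemma connectionsP (P : planar_rep n m) (phi : {ffun side P -> gT}) :
  injective (@next_side n m P) ->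
  reflect [/\ exists p : side P -> gT, forall x, p (next_side x) = p x * phi x,
              forall d, ~~ boundary d -> phi (glue d) = (phi d)^-1,
              forall i, phi (tnth (ins P) i) = tnth g i &
              forall j, phi (tnth (outs P) j) = (tnth h j)^-1]
          (phi \in connections P g h).
Proof.
move=> next_inj; rewrite inE; apply: (iffP and4P).
  case=> /(flat_alongP next_inj) fl /forallP gl /forallP bi /forallP bo.
  by split=> // [d nd|i|j]; apply/eqP => //; apply: (implyP (gl d)).
case=> fl gl bi bo; split; first exact/(flat_alongP next_inj).
- by apply/forallP=> d; apply/implyP=> nd; rewrite gl.
- by apply/forallP=> i; rewrite bi.
- by apply/forallP=> j; rewrite bo.
Qed.

(** For an internal 1-cell this is [pos_internal]; for a cut 1-cell it comes from [cut_posP], since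
    both copies are cut sides. *)
Lemma pos_glue (M : ccs n m) (o : orientation M) (d : side M) :
  ~~ boundary d -> o (glue d) = ~~ o d.
Proof.
move=> nd; have MP := repP M.
case: (glue_cases MP d) => [[cd gd]|[cd od oc gd]].
  by rewrite gd pos_internal // /external -gd.
rewrite gd !(pos_cut o) ?cut_posP //; rewrite /cut /external ?od ?oc eqxx //=.
by rewrite -gd boundary_glue.
Qed.

Lemma holonomy_glue (M : ccs n m) (o : orientation M)
    (c : {ffun one_cell M -> gT}) (d : side M) :
  ~~ boundary d -> holonomy o c (glue d) = (holonomy o c d)^-1.
Proof.
move=> nd; rewrite /holonomy pos_glue //.
have -> : cell_of (glue d) = cell_of d.
  by apply: val_inj; rewrite /= (glueK (repP M)) setUC.
by case: (o d); rewrite ?invgK.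
Qed.

Lemma card_colourings (M : ccs n m) (o : orientation M) :
  #|colourings o g h| = #|connections M g h|.
Proof.
have MP := repP M.
have rep_ex (c : one_cell M) : exists d, val c == [set d; glue d].
  by case: c => c /= /imsetP[d _ ->]; exists d.
(* A side is chosen on each 1-cell, so that the colour can be read off the holonomy along that
   side. *)
pose rp c := xchoose (rep_ex c).
have rpK c : cell_of (rp c) = c.
  by apply: val_inj; rewrite /= -(eqP (xchooseP (rep_ex c))).
pose F (c : {ffun one_cell M -> gT}) := [ffun d : side M => holonomy o c d].
pose F' (phi : {ffun side M -> gT}) : {ffun one_cell M -> gT} :=
  [ffun c => if o (rp c) then phi (rp c) else (phi (rp c))^-1].
have FK : cancel F F'.
  move=> c; apply/ffunP=> e; rewrite !ffunE /holonomy rpK.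
  by case: (o _); rewrite ?invgK.
have flF c : flat_along next_side (F c) = flat o c.
  have prodF d : \prod_(x <- fingraph.orbit next_side d) F c x =
      \prod_(x <- fingraph.orbit next_side d) holonomy o c x.
    by apply: eq_bigr => x _; rewrite ffunE.
  by apply/forallP/forallP => fl d; move: (fl d); rewrite prodF.
(* In sides run along their 1-cells and out sides against them, whence the inverse imposed on [outs]
   in [connections]. *)
have bF c : (forall i, F c (tnth (ins M) i) = c (cell_of (tnth (ins M) i))) /\
    (forall i, F c (tnth (outs M) i) = (c (cell_of (tnth (outs M) i)))^-1).
  split=> i; rewrite ffunE /holonomy; first by rewrite pos_in ?mem_tnth.
  by rewrite (negPf (pos_out o (mem_tnth i _))).
have colF c : (F c \in connections M g h) = (c \in colourings o g h).
  rewrite !inE flF; congr (_ && _).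
  have -> : [forall d : side M, ~~ boundary d ==>
      (F c (glue d) == (F c d)^-1)].
    by apply/forallP=> d; apply/implyP=> nd; rewrite !ffunE holonomy_glue.
  rewrite /=; congr (_ && _); apply/forallP/forallP => bc i; move: (bc i).
  - by rewrite (bF c).1.
  - by rewrite (bF c).1.
  - by rewrite (bF c).2 (inj_eq invg_inj).
  - by rewrite (bF c).2 (inj_eq invg_inj).
(* The chosen side [e] of the 1-cell of [d] is either [d] or its partner; in the second case the
   gluing condition recovers [phi d] from [phi e]. *)
have FK' : {in connections M g h, cancel F' F}.
  move=> phi /(connectionsP _ (next_side_inj MP))[_ gl _ _].
  apply/ffunP=> d; rewrite !ffunE /holonomy !ffunE.
  have := rpK (cell_of d) => /(congr1 val)/= /setP/(_ d).
  set e := rp _; rewrite !inE eqxx /= => /orP[/eqP <-|/eqP de].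
    by case: (o d); rewrite ?invgK.
  have [bd|nd] := boolP (boundary e).
    by rewrite de (eqP bd); case: (o e); rewrite ?invgK.
  by rewrite de pos_glue // gl //; case: (o e); rewrite ?invgK.
apply: (card_in_bij (F := F) (F' := F')) => // [c|phi phiC].
  by rewrite colF.
by rewrite -colF FK'.
Qed.


End Connections.

(** * Internal 0-cells as classes of sides *)

Section ZeroCells.


Variables (n m : nat).

Lemma same_origin_equiv (P : planar_rep n m) (a : side P -> side P) :
  equivalence_rel (same_origin a).
Proof.
have sym : connect_sym [rel x y | turn a x y || turn a y x].
  by apply: sym_connect_sym => x y; rewrite /= orbC.
move=> x y z; split; first exact: connect0.
by move=> xy; apply: (same_connect sym xy).
Qed.

Lemma same_origin_sym (P : planar_rep n m) (a : side P -> side P) :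
  symmetric (same_origin a).
Proof.
case/equivalence_relP: (same_origin_equiv a) => re tr x y.
by apply/idP/idP => xy; rewrite -(tr _ _ xy).
Qed.

(** Turns generate [same_origin], which is symmetric, so forward turns are the only case to
    check. *)
Lemma same_origin_homo (P Q : planar_rep n m) (a : side P -> side P)
    (b : side Q -> side Q) (f : side P -> side Q) :
  (forall x, a x != x -> same_origin b (f x) (f (next_side (a x)))) ->
  forall x y, same_origin a x y -> same_origin b (f x) (f y).
Proof.
move=> fab; apply: connect_homo => x y /orP[] /andP[ax /eqP->].
  exact: fab.
by rewrite [connect _ _ _]same_origin_sym; apply: fab.
Qed.

Lemma same_origin_turn (P : planar_rep n m) (a : side P -> side P) x :
  a x != x -> same_origin a x (next_side (a x)).
Proof. by move=> ax; apply: connect1; rewrite /turn /= ax eqxx. Qed.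

(** These are the sides that start at an internal 0-cell: the ends of a boundary 1-cell are the
    origins of [d] and of [next_side d]. *)
Definition off_boundary (P : planar_rep n m) : {set side P} :=
  [set x | [forall d : side P, boundary d ==>
     ~~ same_0cell x d && ~~ same_0cell x (next_side d)]].

Definition origin (P : planar_rep n m) (x : side P) : {set side P} :=
  [set y | same_0cell x y].

Lemma internal_zero_cellsE (P : planar_rep n m) :
  internal_zero_cells P = [set origin x | x in off_boundary P].
Proof.
have eV (x : side P) : [set y in [set: side P] | same_0cell x y] = origin x.
  by apply/setP=> y; rewrite !inE.
apply/setP=> V; rewrite inE; apply/andP/imsetP.
  case=> /imsetP[x _ ->]; rewrite eV => bx; exists x => //.
  rewrite inE; apply/forallP=> d; move: (forallP bx d); by rewrite !inE.
case=> x; rewrite inE => /forallP bx ->; split.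
  by apply/imsetP; exists x; rewrite ?inE ?eV.
by apply/forallP=> d; move: (bx d); rewrite !inE.
Qed.

(** The last condition on [j] holds only up to a common origin, because a move may insert a new side
    right after a boundary side. *)
Lemma off_boundary_transfer (P Q : planar_rep n m) (j : side P -> side Q) :
  (forall x y, same_0cell (j x) (j y) = same_0cell x y) ->
  (forall d, boundary d -> boundary (j d)) ->
  (forall e, boundary e -> exists2 d, boundary d & e = j d) ->
  (forall d, boundary d -> same_0cell (next_side (j d)) (j (next_side d))) ->
  forall x, (j x \in off_boundary Q) = (x \in off_boundary P).
Proof.
move=> jE jb bj jn x.
have jnE d : boundary d -> same_0cell (j x) (next_side (j d)) =
                          same_0cell x (next_side d).
  move=> bd; rewrite -jE !(same_origin_sym _ (j x)).
  have [_ -> //] := same_origin_equiv (@glue _ _ _)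
    (next_side (j d)) (j (next_side d)) (j x).
  exact: jn.
rewrite !inE; apply/forallP/forallP => H => [d|e]; apply/implyP.
  by move=> bd; move: (H (j d)); rewrite jb //= jE jnE.
by case/bj=> d bd ->; move: (H d); rewrite bd /= jE jnE.
Qed.

(** The internal 0-cells of [P] are counted inside [Q]; what remains is to find the 0-cells of [Q]
    missed by [j]. *)
Lemma card_internal_zero_cells (P Q : planar_rep n m) (j : side P -> side Q) :
  (forall x y, same_0cell (j x) (j y) = same_0cell x y) ->
  #|internal_zero_cells P| = #|[set origin x | x in j @: off_boundary P]|.
Proof.
move=> jE; rewrite internal_zero_cellsE (card_classes _ _ jE) //.
exact: same_origin_equiv.
Qed.

End ZeroCells.

(** * Invariance under isomorphism of planar representations *)

Section Isomorphism.

Variables (n m : nat).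

Section Iso.
Variables (P Q : planar_rep n m) (f : side P -> side Q).
Hypothesis f_iso : rep_iso f.

Lemma rep_iso_inj : injective f.
Proof. by case: f_iso => /bij_inj. Qed.

Lemma rep_iso_next x : f (next_side x) = next_side (f x).
Proof. by case: f_iso. Qed.

Lemma rep_iso_glue x : f (glue x) = glue (f x).
Proof. by case: f_iso => _ _ [fo fc] _; rewrite /glue fo fc. Qed.

Lemma rep_iso_boundary x : boundary (f x) = boundary x.
Proof. by rewrite /boundary -rep_iso_glue (inj_eq rep_iso_inj). Qed.

Lemma rep_iso_ins i : f (tnth (ins P) i) = tnth (ins Q) i.
Proof. by case: f_iso => _ _ _ [<- _]; rewrite tnth_map. Qed.

Lemma rep_iso_outs i : f (tnth (outs P) i) = tnth (outs Q) i.
Proof. by case: f_iso => _ _ _ [_ <-]; rewrite tnth_map. Qed.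

Lemma rep_iso_next_inj :
  injective (@next_side n m Q) -> injective (@next_side n m P).
Proof.
move=> nQ x y /(congr1 f); rewrite !rep_iso_next => /nQ; exact: rep_iso_inj.
Qed.

Lemma rep_iso_inv :
  exists2 f' : side Q -> side P, rep_iso f' & cancel f f' /\ cancel f' f.
Proof.
case: f_iso => -[f' fK f'K] fn [fo fc] [fi fu]; exists f' => //.
split; first by exists f.
- by move=> x; rewrite -{1}[x]f'K -fn fK.
- by split=> x; rewrite -{1}[x]f'K -?fo -?fc fK.
by rewrite -fi -fu; split; apply: val_inj; rewrite /= -map_comp;
   rewrite map_id_in // => x _; rewrite /= fK.
Qed.

End Iso.

Section IsoInvariance.
Variables (P Q : planar_rep n m) (f : side P -> side Q).
Hypothesis f_iso : rep_iso f.

Lemma card_connections_iso (gT : finGroupType) (g : n.-tuple gT)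
    (h : m.-tuple gT) :
  injective (@next_side n m Q) ->
  #|connections P g h| = #|connections Q g h|.
Proof.
(* Stated for any isomorphism, so as to apply both to [f] and to its inverse. *)
have pull (P1 P2 : planar_rep n m) (k : side P1 -> side P2)
      (phi : {ffun side P2 -> gT}) :
    rep_iso k -> injective (@next_side n m P2) ->
    phi \in connections P2 g h -> [ffun x => phi (k x)] \in connections P1 g h.
  move=> k_iso nP2 /(connectionsP _ _ _ nP2)[[p pn] gl bi bo].
  apply/(connectionsP _ _ _ (rep_iso_next_inj k_iso nP2)); split.
  - by exists (p \o k) => x; rewrite /= ffunE rep_iso_next ?pn.
  - by move=> d nd; rewrite !ffunE rep_iso_glue ?gl // rep_iso_boundary.
  - by move=> i; rewrite ffunE rep_iso_ins.
  - by move=> i; rewrite ffunE rep_iso_outs.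
move=> nQ; have nP := rep_iso_next_inj f_iso nQ.
have [f' f'_iso [fK f'K]] := rep_iso_inv f_iso.
apply: (card_in_bij
  (F := fun phi : {ffun side P -> gT} => [ffun x => phi (f' x)])
  (F' := fun phi : {ffun side Q -> gT} => [ffun x => phi (f x)])) => phi.
- exact: pull.
- exact: pull.
- by move=> _; apply/ffunP => x; rewrite !ffunE fK.
- by move=> _; apply/ffunP => x; rewrite !ffunE f'K.
Qed.

Lemma card_internal_zero_cells_iso :
  #|internal_zero_cells P| = #|internal_zero_cells Q|.
Proof.
have [f' f'_iso [fK f'K]] := rep_iso_inv f_iso.
have so (P1 P2 : planar_rep n m) (k : side P1 -> side P2) x y : rep_iso k ->
    same_0cell x y -> same_0cell (k x) (k y).
  move=> k_iso; apply: same_origin_homo => z gz.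
  rewrite rep_iso_next // rep_iso_glue //; apply: same_origin_turn.
  by rewrite -rep_iso_glue // (inj_eq (rep_iso_inj k_iso)).
have fE x y : same_0cell (f x) (f y) = same_0cell x y.
  by apply/idP/idP => [/(so _ _ f')|]; rewrite ?fK; [apply | apply: so].
rewrite (card_internal_zero_cells fE) internal_zero_cellsE.
suff -> : f @: off_boundary P = off_boundary Q by [].
have obE x : (f x \in off_boundary Q) = (x \in off_boundary P).
  apply: off_boundary_transfer => // [d|e be|d _].
  - by rewrite rep_iso_boundary.
  - by exists (f' e); rewrite ?f'K // -(rep_iso_boundary f_iso) f'K.
  - by rewrite rep_iso_next //; apply: connect0.
apply/setP=> y; rewrite -[y]f'K (mem_imset _ _ (rep_iso_inj f_iso)).
by rewrite obE.
Qed.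

End IsoInvariance.
End Isomorphism.

Lemma origin_eq n m (P : planar_rep n m) (x y : side P) :
  same_0cell x y -> origin x = origin y.
Proof.
move=> xy; apply/setP=> z; rewrite !inE.
by have [_ ->] := same_origin_equiv (@glue _ _ _) x y z.
Qed.

Lemma off_boundary_origin n m (P : planar_rep n m) (x y : side P) :
  same_0cell x y -> (x \in off_boundary P) = (y \in off_boundary P).
Proof.
move=> /origin_eq/setP xy; rewrite !inE.
by apply/forallP/forallP => H d; move: (xy d) (xy (next_side d)) (H d);
   rewrite !inE => -> ->.
Qed.

(** * Move I: subdividing a 1-cell *)

Section Subdivision.

Variables (n m : nat) (P : planar_rep n m) (d : side P).
Hypotheses (P_ccs : is_ccs P) (d_inner : ~~ boundary d).
Let Q := subdivide d.
Implicit Types x y : side P.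

Lemma boundary_neq x : boundary x -> (x == d) = false /\ (x == glue d) = false.
Proof.
move=> bx; split; apply: contraTF bx => /eqP ->; first by [].
by rewrite boundary_glue.
Qed.

(** Exactly one of [opp_side] and [cut_twin] moves [d], so the composite of the two subdivided
    pairings has the same form for internal and for cut 1-cells. *)
Lemma subdivide_glueE (z : side Q) :
  glue z = match z with
           | inl y => if y == d then inr false
                      else if y == glue d then inr true else inl (glue y)
           | inr b => inl (if b then glue d else d)
           end.
Proof.
case: z => [y|b]; rewrite {1}/glue /= /subdivide_pairing.
  case: (glue_cases P_ccs y) => [[cy gy]|[ncy oy ocy gy]].
    rewrite cy eqxx -gy; case: eqP => // /eqP by_.
    have [-> ->] := boundary_neq by_; congr inl; exact/esym/eqP.
  rewrite (negPf ncy) -gy; case: eqP => [yd|_].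
    by rewrite -yd gy ocy eqxx.
  case: eqP => [yd|_]; last by rewrite gy ocy eqxx.
  by rewrite -[d](glueK P_ccs) -yd gy ocy eqxx.
set y := if b then d else glue d.
have -> : (if b then glue d else d) = glue y.
  by rewrite /y; case: (b); rewrite ?(glueK P_ccs).
have ny : (glue y == y) = false.
  by apply: negPf; rewrite /y; case: (b); rewrite -/(boundary _) ?boundary_glue.
case: (glue_cases P_ccs y) => [[cy gy]|[ncy oy ocy gy]].
  by rewrite cy eqxx -gy ny.
by rewrite (negPf ncy) ocy eqxx gy.
Qed.

Lemma subdivide_boundary_inl x : boundary (inl x : side Q) = boundary x.
Proof.
rewrite {1}/boundary subdivide_glueE.
case: (eqVneq x d) => [->|xd]; first by rewrite (negPf d_inner).
case: (eqVneq x (glue d)) => [->|xd'] //.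
by rewrite boundary_glue // (negPf d_inner).
Qed.

Lemma subdivide_boundary_inr b : boundary (inr b : side Q) = false.
Proof. by rewrite /boundary subdivide_glueE. Qed.

(** If the partner of an old side is now a second half, [next_side] continues past it exactly as it
    did past the undivided side. *)
Lemma subdivide_turn_inl x :
  next_side (glue (inl x : side Q)) = inl (next_side (glue x)).
Proof.
rewrite subdivide_glueE /=.
case: (eqVneq x d) => [->|xd] //=.
case: (eqVneq x (glue d)) => [->|xd'] /=; first by rewrite glueK.
by rewrite !(glue_eq P_ccs) glueK // (negPf xd) (negPf xd').
Qed.

Lemma subdivide_turn_inr b :
  next_side (glue (inr b : side Q)) = inr (~~ b).
Proof.
have gd : (glue d == d) = false by apply: negPf.
by rewrite subdivide_glueE /=; case: b; rewrite /= eqxx ?gd.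
Qed.

Lemma subdivide_same_0cell x y :
  same_0cell (inl x : side Q) (inl y) = same_0cell x y.
Proof.
apply/idP/idP.
  (* The value at the new sides is arbitrary: turns exchange these two sides and never reach an old
     one. *)
  pose r (z : side Q) : side P := if z is inl t then t else d.
  apply: (same_origin_homo (f := r)) => -[t|b] nz.
    rewrite subdivide_turn_inl /=; apply: same_origin_turn.
    by move: nz; rewrite -[_ == _]/(boundary _) subdivide_boundary_inl.
  by rewrite subdivide_turn_inr; apply: connect0.
apply: (same_origin_homo (f := inl : side P -> side Q)) => t nt.
rewrite -subdivide_turn_inl; apply: same_origin_turn.
by rewrite -[_ == _]/(boundary _) subdivide_boundary_inl.
Qed.

Lemma subdivide_new_0cell : same_0cell (inr true : side Q) (inr false).
Proof.
rewrite -(subdivide_turn_inr true); apply: same_origin_turn.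
by rewrite subdivide_glueE.
Qed.

Lemma subdivide_new_0cell_disjoint x b :
  same_0cell (inr b : side Q) (inl x) = false.
Proof.
(* [k] tells old sides from new ones and is constant along turns. *)
apply/negP=> bx; pose k (z : side Q) := if z is inl _ then true else false.
have : connect [rel u v : bool | u == v] (k (inr b)) (k (inl x)).
  have kE (u : side Q) : k (next_side (glue u)) = k u.
    by case: u => t; rewrite ?subdivide_turn_inl ?subdivide_turn_inr.
  apply: connect_homo bx => u v /orP[] /andP[_ /eqP->]; apply: connect1;
    by rewrite /= kE eqxx.
by case/connectP=> p; elim: p => [|[] p IHp] //= pp kk; apply: IHp.
Qed.

Lemma subdivide_next_boundary x :
  boundary x -> next_side (inl x : side Q) = inl (next_side x).
Proof. by move=> /boundary_neq[/= -> ->]. Qed.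

(** Old 0-cells keep their status. Both second halves start at a single new 0-cell, which meets no
    boundary 1-cell because the subdivided 1-cell is not one. *)
Lemma card_internal_zero_cells_subdivide :
  #|internal_zero_cells Q| = #|internal_zero_cells P|.+1.
Proof.
rewrite (card_internal_zero_cells subdivide_same_0cell) internal_zero_cellsE.
have obE x : ((inl x : side Q) \in off_boundary Q) = (x \in off_boundary P).
  apply: (off_boundary_transfer (j := inl : side P -> side Q))
    => [|e be|[e|b]|e be].
  - exact: subdivide_same_0cell.
  - by rewrite subdivide_boundary_inl.
  - by rewrite subdivide_boundary_inl => be; exists e.
  - by rewrite subdivide_boundary_inr.
  - by rewrite subdivide_next_boundary //; apply: connect0.
have newE : (inr true : side Q) \in off_boundary Q.
  rewrite inE; apply/forallP => -[e|b]; rewrite ?subdivide_boundary_inr //.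
  rewrite subdivide_boundary_inl; apply/implyP => be.
  by rewrite subdivide_next_boundary // !subdivide_new_0cell_disjoint.
have -> : [set origin z | z in off_boundary Q] =
    origin (inr true : side Q) |:
      [set @origin n m Q z | z in [set (inl x : side Q) | x in off_boundary P]].
  apply/setP=> V; rewrite in_setU1; apply/imsetP/orP.
    case=> -[x|b] ob ->; [right | left].
      by rewrite !imset_f // -obE.
    case: b {ob} => //; apply/eqP/esym/origin_eq/subdivide_new_0cell.
  case=> [/eqP->|]; first by exists (inr true).
  by case/imsetP=> _ /imsetP[x ox ->] ->; exists (inl x); rewrite ?obE.
(* The new class differs from every old one because it contains no old side. *)
rewrite cardsU1; case: imsetP => //= -[_ /imsetP[x _ ->] /setP/(_ (inl x))].
by rewrite !inE subdivide_new_0cell_disjoint [same_origin _ _ _]connect0.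
Qed.

Lemma card_connections_subdivide (gT : finGroupType) (g : n.-tuple gT)
    (h : m.-tuple gT) :
  injective (@next_side n m Q) ->
  #|connections Q g h| = (#|gT| * #|connections P g h|)%N.
Proof.
move=> nQ; have nP := next_side_inj P_ccs.
have gd_neq : (glue d == d) = false by apply: negPf.
rewrite -cardsT -cardsX.
(* The first component keeps the free holonomy of the first half of [d]; the second multiplies the
   holonomies of the two halves of each subdivided side. *)
pose F (psi : {ffun side Q -> gT}) : gT * {ffun side P -> gT} :=
  (psi (inl d), [ffun x => if x == d then psi (inl d) * psi (inr true)
     else if x == glue d then psi (inl (glue d)) * psi (inr false)
     else psi (inl x)]).
(* Giving [k] to the first half of [d] fixes its partner [inr false]. The total [phi d] then fixes
   [inr true], hence also its partner, the first half of [glue d]. *)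
pose F' (kphi : gT * {ffun side P -> gT}) : {ffun side Q -> gT} :=
  let k := kphi.1 in let phi := kphi.2 in
  [ffun z => match z with
             | inl x => if x == d then k
                        else if x == glue d then (phi d)^-1 * k else phi x
             | inr b => if b then k^-1 * phi d else k^-1
             end].
apply: (card_in_bij (F := F) (F' := F')) => [psi|[k phi]|psi|[k phi]].
- move=> /(connectionsP _ _ _ nQ)[[p pn] gl bi bo]; rewrite in_setX in_setT /=.
  have gld : psi (inr false) = (psi (inl d))^-1.
    by rewrite -gl ?subdivide_boundary_inl // subdivide_glueE eqxx.
  have gld' : psi (inl (glue d)) = (psi (inr true))^-1.
    by rewrite -gl ?subdivide_boundary_inr // subdivide_glueE.
  apply/(connectionsP _ _ _ nP); split.
  + exists (p \o inl) => x; rewrite /= ffunE.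
    have := pn (inl x) => /=; case: (eqVneq x d) => [->|xd].
      by have := pn (inr true) => /= -> ->; rewrite mulgA.
    case: (eqVneq x (glue d)) => [->|xd'] //.
    by have := pn (inr false) => /= -> ->; rewrite mulgA.
  + move=> x nx; rewrite !ffunE !(glue_eq P_ccs) glueK //.
    case: (eqVneq x d) => [->|xd].
      by rewrite eq_sym gd_neq gld gld' invMg.
    case: (eqVneq x (glue d)) => [_|xd'].
      by rewrite gld gld' invMg !invgK.
    rewrite -gl ?subdivide_boundary_inl // subdivide_glueE.
    by rewrite (negPf xd) (negPf xd').
  + move=> i; rewrite ffunE.
    have [-> ->] := boundary_neq (boundary_ins P_ccs i).
    by rewrite -bi tnth_map.
  + move=> i; rewrite ffunE.
    have [-> ->] := boundary_neq (boundary_outs P_ccs i).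
    by rewrite -bo tnth_map.
- rewrite in_setX in_setT /= => /(connectionsP _ _ _ nP)[[p pn] gl bi bo].
  apply/(connectionsP _ _ _ nQ); split.
  (* The potential at a new corner is the one reached after the first half of the side. *)
  + exists (fun z : side Q => match z with inl x => p x
        | inr b => if b then p d * k else p (glue d) * ((phi d)^-1 * k) end).
    case=> [x|[]]; rewrite /= ffunE.
    * case: (eqVneq x d) => [->|xd] //.
      by case: (eqVneq x (glue d)) => [->|xd'] //.
    * by rewrite pn mulgA mulgK.
    * by rewrite pn gl // !mulgA mulgK.
  + case=> [x|b]; rewrite ?subdivide_boundary_inl ?subdivide_boundary_inr => nx;
      rewrite subdivide_glueE !ffunE.
      case: (eqVneq x d) => [//|xd].
      case: (eqVneq x (glue d)) => [_|xd'].
        by rewrite invMg invgK.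
      by rewrite !(glue_eq P_ccs) glueK // (negPf xd) (negPf xd') gl.
    by case: b {nx}; rewrite ?eqxx ?gd_neq ?invgK ?invMg ?invgK.
  + move=> i; rewrite tnth_map ffunE.
    by have [-> ->] := boundary_neq (boundary_ins P_ccs i).
  + move=> i; rewrite tnth_map ffunE.
    by have [-> ->] := boundary_neq (boundary_outs P_ccs i).
- move=> /(connectionsP _ _ _ nQ)[_ gl _ _].
  have gld : psi (inr false) = (psi (inl d))^-1.
    by rewrite -gl ?subdivide_boundary_inl // subdivide_glueE eqxx.
  have gld' : psi (inl (glue d)) = (psi (inr true))^-1.
    by rewrite -gl ?subdivide_boundary_inr // subdivide_glueE.
  apply/ffunP => -[x|b]; rewrite !ffunE /= eqxx.
    case: (eqVneq x d) => [->|xd] //.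
    by case: (eqVneq x (glue d)) => [->|//]; rewrite gld' invMg mulgKV.
  by case: b; rewrite ?mulKg ?gld.
- rewrite in_setX in_setT /= => /(connectionsP _ _ _ nP)[_ gl _ _].
  rewrite /F; congr pair; first by rewrite ffunE eqxx.
  apply/ffunP=> x; rewrite !ffunE !eqxx gd_neq.
  case: (eqVneq x d) => [->|xd]; first by rewrite mulKVg.
  by case: (eqVneq x (glue d)) => [->|//]; rewrite mulgK gl.
Qed.

End Subdivision.

(** * Move II: splitting a 2-cell *)

Section FaceSplitting.

Variables (n m : nat) (P : planar_rep n m) (x y : side P).
Hypotheses (P_ccs : is_ccs P) (xy : fconnect next_side x y).
Let Q := split_face x y.
Implicit Types t : side P.

Lemma split_boundary_inr b : boundary (inr b : side Q) = false.
Proof. by case: b. Qed.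

(** The new 1-cell leads from the origin of [x] to that of [y] along [inr true], and back along
    [inr false]. *)
Lemma split_same_0cell_inr b :
  same_0cell (inr b : side Q) (inl (if b then x else y)).
Proof.
have turn c : same_0cell (inr c : side Q) (next_side (inr (~~ c) : side Q)).
  by apply: (same_origin_turn (a := @glue n m Q)); case: c.
have yP : same_0cell (inr false : side Q) (inl y) by apply: turn.
(* If [x = y], the new 1-cell is a loop: [inr true] turns to [inr false], and one more turn reaches
   [inl y]. *)
case: b => //; have := turn true; rewrite /=; case: eqVneq => // xy_eq xt.
by rewrite [in inl _]xy_eq; apply: connect_trans xt yP.
Qed.

Lemma split_same_0cell_next t :
  same_0cell (next_side (inl t : side Q)) (inl (next_side t)).
Proof.
rewrite /=; case: eqVneq => [->|_]; first exact: (split_same_0cell_inr true).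
case: eqVneq => [->|_]; last exact: connect0.
exact: (split_same_0cell_inr false).
Qed.

Lemma split_same_0cell t u :
  same_0cell (inl t : side Q) (inl u) = same_0cell t u.
Proof.
apply/idP/idP.
  (* Each new side is collapsed to the old side with the same origin, so that its turns become
     trivial. *)
  pose r (z : side Q) : side P :=
    match z with inl v => v | inr b => if b then x else y end.
  have rE v : r (next_side (inl v : side Q)) = next_side v.
    by rewrite /=; case: eqVneq => // _; case: eqVneq.
  apply: (same_origin_homo (f := r)) => -[v|b] nz.
    by rewrite -[glue _]/(inl (glue v) : side Q) rE; apply: same_origin_turn.
  rewrite -[glue _]/(inr (~~ b) : side Q).
  suff -> : r (next_side (inr (~~ b) : side Q)) = r (inr b) by apply: connect0.
  by case: b {nz} => //=; case: eqVneq => [->|].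
apply: (same_origin_homo (f := inl : side P -> side Q)) => v nv.
apply: connect_trans (split_same_0cell_next (glue v)).
exact: (same_origin_turn (a := @glue n m Q)).
Qed.

(** Each new side starts at an old 0-cell, so every class already contains an old side. *)
Lemma card_internal_zero_cells_split :
  #|internal_zero_cells Q| = #|internal_zero_cells P|.
Proof.
rewrite (card_internal_zero_cells split_same_0cell) internal_zero_cellsE.
have obE t : ((inl t : side Q) \in off_boundary Q) = (t \in off_boundary P).
  apply: (off_boundary_transfer (j := inl : side P -> side Q)) => //.
  - exact: split_same_0cell.
  - by case=> [e|b]; rewrite ?split_boundary_inr // => be; exists e.
  - by move=> e _; apply: split_same_0cell_next.
congr #|pred_of_set _|; apply/setP=> V; apply/imsetP/imsetP; last first.
  by case=> _ /imsetP[t ot ->] ->; exists (inl t); rewrite ?obE.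
case=> -[t|b] ob ->; first by exists (inl t); rewrite ?imset_f -?obE.
have bt := split_same_0cell_inr b.
exists (inl (if b then x else y)); last exact: origin_eq.
by rewrite imset_f // -obE -(off_boundary_origin bt).
Qed.

(* The sides of the new 2-cell that starts at [x], without the new 1-cell. *)
Definition first_face : pred (side P) :=
  [pred t in traject next_side x (findex next_side x y)].

Lemma first_faceP t :
  reflect (exists2 i, i < findex next_side x y & t = iter i next_side x)
          (first_face t).
Proof. exact: trajectP. Qed.

Lemma first_face_start : first_face x = (x != y).
Proof.
rewrite /first_face /=; have := findex_eq0 next_side x y.
by case: findex => [|k] /= <-; rewrite ?inE ?eqxx.
Qed.

Lemma first_face_end : first_face y = false.
Proof.
apply/first_faceP => -[i lt_i /(congr1 (findex next_side x))].
rewrite findex_iter; first by move=> e; rewrite e ltnn in lt_i.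
exact: ltn_trans lt_i (findex_max xy).
Qed.

(** Away from the ends of the new 1-cell, [next_side] stays within one of the two new 2-cells; a
    potential rescaled on one of them needs checking only at these ends. *)
Lemma first_face_next t :
  next_side t != x -> next_side t != y ->
  first_face (next_side t) = first_face t.
Proof.
move=> tx ty; apply/first_faceP/first_faceP => [[[|i] lt_i]|[i lt_i tE]].
- by move/eqP; rewrite (negPf tx).
- by rewrite iterS => /(next_side_inj P_ccs) ->; exists i => //; apply: ltnW.
exists i.+1; last by rewrite iterS tE.
rewrite ltn_neqAle lt_i andbT; apply: contraNneq ty => e.
by rewrite tE -iterS e iter_findex.
Qed.

Lemma first_face_last t : next_side t = x -> first_face t = false.
Proof.
move=> tx; apply/first_faceP => -[i lt_i tE].
(* Since [i.+1] is still below the order of the orbit, the index of [x] would be both [i.+1] and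
   [0]. *)
have := findex_iter (leq_ltn_trans lt_i (findex_max xy)).
by rewrite iterS -tE tx findex0.
Qed.

Lemma first_face_before_end t : x != y -> next_side t = y -> first_face t.
Proof.
rewrite -(findex_eq0 next_side) => k_gt0 ty; apply/first_faceP.
exists (findex next_side x y).-1; first by rewrite prednK ?lt0n.
apply: (next_side_inj P_ccs).
by rewrite -iterS prednK ?lt0n // iter_findex.
Qed.

(** Forgetting the holonomy of the new 1-cell is a bijection; the inverse recovers it as the product
    [w] along the old sides from [x] to [y]. *)
Lemma card_connections_split (gT : finGroupType) (g : n.-tuple gT)
    (h : m.-tuple gT) :
  injective (@next_side n m Q) ->
  #|connections Q g h| = #|connections P g h|.
Proof.
move=> nQ; have nP := next_side_inj P_ccs.
pose w (phi : side P -> gT) :=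
  \prod_(t <- traject next_side x (findex next_side x y)) phi t.
have wE (phi p : side P -> gT) :
    (forall t, p (next_side t) = p t * phi t) -> p y = p x * w phi.
  by move=> pn; rewrite -(prod_traject pn) iter_findex.
pose F (psi : {ffun side Q -> gT}) : {ffun side P -> gT} :=
  [ffun t => psi (inl t)].
pose F' (phi : {ffun side P -> gT}) : {ffun side Q -> gT} :=
  [ffun z => match z with
             | inl t => phi t
             | inr b => if b then w phi else (w phi)^-1
             end].
(* This serves twice: it makes [F psi] flat, and its second clause shows that [psi (inr true)] is
   forced. *)
have potential psi : psi \in connections Q g h ->
    exists2 p : side P -> gT,
      (forall t, p (next_side t) = p t * F psi t) &
      p y = p x * psi (inr true).
  case/(connectionsP _ _ _ nQ)=> [[p pn] gl _ _].
  have psi_false : psi (inr false) = (psi (inr true))^-1 by rewrite -gl.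
  have px : x != y -> p (inl x) = p (inr false) * (psi (inr true))^-1.
    by move=> nxy; rewrite -psi_false -pn /= (negPf nxy).
  have py : p (inl y) = p (inr true) * psi (inr true) by rewrite -pn.
  (* If [x = y], then [inr false] bounds a 2-cell by itself, so its holonomy is trivial. *)
  have psi1 : x = y -> psi (inr true) = 1.
    move=> exy; have := pn (inr false); rewrite /= exy eqxx psi_false.
    by rewrite -{1}[p _]mulg1 => /mulgI/eqP; rewrite eq_sym eq_invg1 => /eqP.
  (* Left multiplication by a constant preserves potentials; this constant matches the values at
     [inl x] and [inr true], which share their origin. *)
  pose c := p (inr true) * (p (inl x))^-1.
  have cx : c * p (inl x) = p (inr true) by rewrite mulgKV.
  (* The two 2-cells may carry unrelated potentials; rescaling by [c] makes them
     agree across the new 1-cell. *)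
  exists (fun t => if first_face t then c * p (inl t) else p (inl t));
    last first.
    rewrite first_face_start first_face_end.
    case: eqVneq => [exy|_] /=; first by rewrite exy psi1 // mulg1.
    by rewrite cx py.
  move=> t; rewrite ffunE.
  have [tx|tx] := eqVneq (next_side t) x.
    rewrite tx first_face_start first_face_last //.
    have := pn (inl t); rewrite /= tx eqxx => <-.
    by case: eqVneq => [exy|_] //=; rewrite ?exy ?py ?psi1 ?mulg1.
  have [ty|ty] := eqVneq (next_side t) y.
    have nxy : x != y by rewrite -ty eq_sym.
    rewrite ty first_face_end first_face_before_end // -mulgA.
    have := pn (inl t); rewrite /= (negPf tx) ty eqxx => <-.
    have -> : p (inr false) = p (inl x) * psi (inr true).
      by rewrite px // mulgKV.
    by rewrite mulgA cx py.
  have := pn (inl t); rewrite /= (negPf tx) (negPf ty) => ->.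
  by rewrite first_face_next //; case: ifP; rewrite ?mulgA.
apply: (card_in_bij (F := F) (F' := F')) => [psi psiC|phi|psi psiC|phi _].
- have [p pn _] := potential _ psiC.
  case/(connectionsP _ _ _ nQ): psiC => [_ gl bi bo].
  apply/(connectionsP _ _ _ nP); split; first by exists p.
  + by move=> t nt; rewrite !ffunE -gl.
  + by move=> i; rewrite ffunE -bi tnth_map.
  + by move=> i; rewrite ffunE -bo tnth_map.
- case/(connectionsP _ _ _ nP)=> [[p pn] gl bi bo].
  apply/(connectionsP _ _ _ nQ); split.
  (* A new side receives the potential of the old side with the same origin. *)
  + exists (fun z : side Q => match z with inl t => p t
        | inr b => if b then p x else p y end).
    case=> [t|[]]; rewrite ffunE /=.
    * by rewrite -pn; case: eqVneq => [->|_] //; case: eqVneq => [->|_].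
    * exact: wE.
    (* If [x = y], the side [inr false] is its own successor, which requires [w phi] to be [1]. *)
    * case: eqVneq => [exy|_]; last by rewrite (wE _ _ pn) mulgK.
      have /mulgI <- : p x * 1 = p x * w phi by rewrite -(wE _ _ pn) mulg1 exy.
      by rewrite invg1 mulg1.
  + case=> [t|b] nt; rewrite !ffunE /=; first exact: gl.
    by case: b {nt}; rewrite /= ?invgK.
  + by move=> i; rewrite tnth_map ffunE.
  + by move=> i; rewrite tnth_map ffunE.
- have [p pn pxy] := potential _ psiC.
  have psi_true : psi (inr true) = w (F psi).
    by apply: (mulgI (p x)); rewrite -pxy (wE _ _ pn).
  case/(connectionsP _ _ _ nQ): psiC => [_ gl _ _].
  apply/ffunP=> -[t|[]]; rewrite ffunE ?ffunE //.
  by rewrite -psi_true -gl.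
- by apply/ffunP => t; rewrite !ffunE.
Qed.

End FaceSplitting.

(** * Comparison of the normalised counts *)

Section Invariance.

Variables (R : realType) (gT : finGroupType) (n m : nat).
Variables (g : n.-tuple gT) (h : m.-tuple gT).

(** The orientation disappears from the right-hand side, so surfaces with unrelated orientations can
    be compared. *)
Lemma ccs_invariantE (M : ccs n m) (o : orientation M) :
  ccs_invariant o R h g =
  (1 / (#|gT|%:R `^ ((m + n)%:R / 2 + #|internal_zero_cells M|%:R))
     * #|connections M g h|%:R)%R.
Proof. by rewrite /ccs_invariant card_colourings. Qed.

Lemma introduces_zero_cell_invariant (M M' : ccs n m) (o : orientation M)
    (o' : orientation M') :
  introduces_zero_cell M M' -> ccs_invariant o R h g = ccs_invariant o' R h g.
Proof.
case=> d [f [nd f_iso _]]; have nM' := next_side_inj (repP M').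
rewrite !ccs_invariantE -(card_connections_iso f_iso g h nM').
rewrite -(card_internal_zero_cells_iso f_iso).
rewrite card_internal_zero_cells_subdivide ?card_connections_subdivide //;
  try exact: repP; try exact: (rep_iso_next_inj f_iso nM').
have G0 : (#|gT|%:R != 0 :> R)%R.
  by rewrite pnatr_eq0 -lt0n; apply/card_gt0P; exists 1.
(* The extra internal 0-cell contributes one more power of the order of the group to the
   denominator, which cancels the same factor in the number of connections. *)
rewrite -[in RHS](natr1 #|_|) addrA [in RHS]powRD; last by rewrite G0 implybT.
by rewrite powRr1 ?ler0n // natrM !div1r invfM -mulrA mulKf.
Qed.

Lemma introduces_one_cell_invariant (M M' : ccs n m) (o : orientation M)
    (o' : orientation M') :
  introduces_one_cell M M' -> ccs_invariant o R h g = ccs_invariant o' R h g.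
Proof.
case=> x [y [f [xy f_iso _]]]; have nM' := next_side_inj (repP M').
rewrite !ccs_invariantE -(card_connections_iso f_iso g h nM').
rewrite -(card_internal_zero_cells_iso f_iso).
rewrite card_internal_zero_cells_split card_connections_split //.
  exact: repP.
exact: (rep_iso_next_inj f_iso nM').
Qed.

End Invariance.

Theorem theorem4p5 (R : realType) (gT : finGroupType) (n m : nat)
    (M M' : ccs n m) (o : orientation M) (o' : orientation M')
    (g : n.-tuple gT) (h : m.-tuple gT) :
  moveI M M' \/ moveII M M' ->
  ccs_invariant o R h g = ccs_invariant o' R h g.
Proof.
case=> -[].
- exact: introduces_zero_cell_invariant.
- by move=> mv; apply/esym/introduces_zero_cell_invariant.
- exact: introduces_one_cell_invariant.
- by move=> mv; apply/esym/introduces_one_cell_invariant.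
Qed.
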